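(* The number of linear equivalence classes of $2$-level $d$-configurations is at most $2^{O(d^2\log^3 d)}$.
   Context: A \emph{$2$-level $d$-configuration} is a pair $(A,B)$ of sets $A,B\subseteq\mathbb{R}^d$, each linearly spanning $\mathbb{R}^d$, such that $\langle a,b\rangle=a^{\top}b\in\{0,1\}$ for all $a\in A$, $b\in B$, and which are maximal with respect to this property, i.e. $A=\{a\in\mathbb{R}^d:\langle a,b\rangle\in\{0,1\}\ \forall b\in B\}$ and $B=\{b\in\mathbb{R}^d:\langle a,b\rangle\in\{0,1\}\ \forall a\in A\}$. Two $2$-level $d$-configurations $(A,B)$ and $(A',B')$ are \emph{linearly equivalent} if there is a non-singular $M\in\mathbb{R}^{d\times d}$ with $A'=\{M^{-\top}a: a\in A\}$ and $B'=\{Mb: b\in B\}$. Logarithms are base $2$. *)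

(* Defs.v *)
From HB Require Import structures.
From mathcomp Require Export all_boot all_order all_algebra.
From mathcomp Require Export finmap.
From mathcomp Require Export all_classical all_reals all_analysis.

Set Implicit Arguments.
Unset Strict Implicit.
Unset Printing Implicit Defensive.

Import Order.TTheory GRing.Theory Num.Theory.
Import numFieldNormedType.Exports.

Local Open Scope classical_set_scope.
Local Open Scope ring_scope.

Section TwoLevelConfigurations.
Variables (R : realType) (d : nat).

Definition dotv (a b : 'cV[R]_d) : R := (a^T *m b) 0 0.

(* [A] may be infinite, whereas [<<X>>%VS] is the span of a finite sequence. *)
Definition linearly_spanning (A : set 'cV[R]_d) : Prop :=
  forall v : 'cV[R]_d,
    exists2 X : seq 'cV[R]_d, (forall x, x \in X -> A x) & v \in <<X>>%VS.

Definition zero_one (x : R) : Prop := x = 0 \/ x = 1.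

Definition config : Type := (set 'cV[R]_d * set 'cV[R]_d)%type.

Definition two_level_config (c : config) : Prop :=
  [/\ linearly_spanning c.1,
      linearly_spanning c.2,
      forall a b, c.1 a -> c.2 b -> zero_one (dotv a b),
      c.1 = [set a | forall b, c.2 b -> zero_one (dotv a b)] &
      c.2 = [set b | forall a, c.1 a -> zero_one (dotv a b)]].

Definition linearly_equivalent (c c' : config) : Prop :=
  exists2 M : 'M[R]_d, M \in unitmx &
    c'.1 = [set (invmx M)^T *m a | a in c.1] /\
    c'.2 = [set M *m b | b in c.2].

Lemma linearly_equivalent_refl c : linearly_equivalent c c.
Proof.
exists 1%:M; first exact: unitmx1.
rewrite invmx1 trmx1; split; apply/seteqP; split => [x cx|x [y cy <-]].
- by exists x => //; rewrite mul1mx.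
- by rewrite mul1mx.
- by exists x => //; rewrite mul1mx.
- by rewrite mul1mx.
Qed.

Lemma linearly_equivalent_sym c c' :
  linearly_equivalent c c' -> linearly_equivalent c' c.
Proof.
move=> [M uM [e1 e2]]; exists (invmx M); first by rewrite unitmx_inv.
rewrite invmxK e1 e2 !image_comp; split; rewrite -[LHS]image_id.
- by apply: eq_imagel => a _ /=; rewrite mulmxA -trmx_mul mulVmx // trmx1 mul1mx.
- by apply: eq_imagel => b _ /=; rewrite mulmxA mulVmx // mul1mx.
Qed.

Lemma linearly_equivalent_trans c c' c'' :
  linearly_equivalent c c' -> linearly_equivalent c' c'' ->
  linearly_equivalent c c''.
Proof.
move=> [M uM [e1 e2]] [N uN [f1 f2]]; exists (N *m M).
  by rewrite unitmx_mul uN.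
have invNM : invmx (N *m M) = invmx M *m invmx N.
  apply: (can_inj (mulKmx (_ : N *m M \in unitmx))).
    by rewrite unitmx_mul uN.
  by rewrite mulmxV ?unitmx_mul ?uN // mulmxA mulmxK // mulmxV.
rewrite f1 f2 e1 e2 !image_comp; split; apply: eq_imagel => x _ /=.
- by rewrite invNM trmx_mul mulmxA.
- by rewrite mulmxA.
Qed.

Definition equiv_class (c : config) : set config :=
  [set c' | two_level_config c' /\ linearly_equivalent c c'].

Definition equiv_classes : set (set config) :=
  [set equiv_class c | c in [set c | two_level_config c]].

End TwoLevelConfigurations.

Definition log2 (R : realType) (x : R) : R := ln x / ln 2.

(* Main.v *)
Require Import Defs.
From mathcomp Require Import perm ring lra zify.
Set Implicit Arguments.
Unset Strict Implicit.
Unset Printing Implicit Defensive.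
Import Order.TTheory GRing.Theory Num.Theory.
Import numFieldNormedType.Exports.
Local Open Scope classical_set_scope.
Local Open Scope ring_scope.

(* In coordinates given by a basis of [B] we have [A] inside {0,1}^d, and if that
   basis has maximal determinant then all of [B] lies in [-1,1]^d.  A vector [a]
   of {0,1}^d lies in [A] iff the quadratic forms [<a,b>^2 - <a,b>], for [b] in
   [B], vanish at [a].  They span a space of dimension at most d^2; let [Q] be
   the sum of d^2 of them spanning it.  The condition that [<a,b>] is an integer
   for all [b] in [B] needs only O(d log d) vectors [b] to be tested, because the
   0/1 matrix of pairings of two bases has determinant at most d!, so that a
   chain of lattices doubles its density at most O(d log d) times.  For the [a]
   satisfying it each form takes a nonnegative integer value, so [Q] vanishes
   on [A] and is at least 1 elsewhere.  The coefficients of [Q] being O(d^2), it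
   may be rounded to precision 1/(d^2+1), which takes O(log d) bits per
   coefficient.  The pairing matrix, the tested vectors (d bits each) and the
   rounded form determine the class: O(d^2 log d) bits in all. *)

(** * Column replacement and Cramer's rule *)

Definition subst_col (T : Type) (m n : nat) (M : 'M[T]_(m, n)) (j0 : 'I_n)
    (v : 'cV[T]_m) : 'M[T]_(m, n) :=
  \matrix_(i, j) if j == j0 then v i 0 else M i j.

Lemma mulmx_subst_col (F : comPzRingType) (m n p : nat) (M : 'M[F]_(m, n))
    (N : 'M[F]_(n, p)) j0 v :
  M *m subst_col N j0 v = subst_col (M *m N) j0 (M *m v).
Proof.
apply/matrixP => i j; rewrite !mxE; case: eqP => [->|/eqP/negPf ne].
  by apply: eq_bigr => k _; rewrite !mxE eqxx.
by apply: eq_bigr => k _; rewrite !mxE ne.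
Qed.

Lemma det_subst_col1 (F : comNzRingType) (d : nat) (i : 'I_d) (z : 'cV[F]_d) :
  \det (subst_col 1%:M i z) = z i 0.
Proof.
rewrite (expand_det_row _ i) (bigD1 i) //= big1 ?addr0 => [|j ne_ji].
  rewrite !mxE eqxx /cofactor (_ : row' _ _ = 1%:M) ?det1.
    by rewrite -signr_odd addnn odd_double mulr1 mulr1.
  apply/matrixP => k l; rewrite !mxE eq_sym (negPf (neq_lift _ _)).
  by rewrite (inj_eq lift_inj).
by rewrite !mxE (negPf ne_ji) eq_sym (negPf ne_ji) mul0r.
Qed.

(* Cramer's rule *)
Lemma det_subst_col (F : comNzRingType) (d : nat) (M : 'M[F]_d) i z :
  \det (subst_col M i (M *m z)) = \det M * z i 0.
Proof. by rewrite -{1}[M]mulmx1 -mulmx_subst_col det_mulmx det_subst_col1. Qed.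

(** A free sequence in [P] is extended by any element of [P] outside its span; [n] bounds the
    codimension left. The set [P] may be infinite. *)
Lemma free_generating_seq (K : fieldType) (vT : vectType K) (P : set vT) :
  exists Y : seq vT,
    [/\ free Y, forall y, y \in Y -> P y & forall v, P v -> v \in <<Y>>%VS].
Proof.
suff: forall n (Y : seq vT), (\dim {:vT} - size Y <= n)%N -> free Y ->
    (forall y, y \in Y -> P y) -> exists Y : seq vT,
    [/\ free Y, forall y, y \in Y -> P y & forall v, P v -> v \in <<Y>>%VS].
  by apply; [exact: leqnn | exact: nil_free | ].
elim=> [|n IH] Y leY fY PY; have [?|] := pselect (forall v, P v -> v \in <<Y>>%VS);
    try by exists Y.
all: move=> /existsNP[v /not_implyP[Pv /negP nv]].
all: have fvY : free (v :: Y) by rewrite free_cons nv.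
all: have ltY : (size Y < \dim {:vT})%N
  by have := dimvS (subvf <<v :: Y>>); rewrite (eqP fvY).
  by move: leY; rewrite leqn0 subn_eq0 leqNgt ltY.
apply: (IH (v :: Y)) => //= [|y].
  by rewrite subnS; move: leY; case: (_ - _)%N.
by rewrite inE => /orP[/eqP->//|]; exact: PY.
Qed.

Section Configurations.
Variable R : realType.

(** * Integer matrices and integrality tests *)

Definition int_mx (m n : nat) (M : 'M[R]_(m, n)) :=
  forall i j, M i j \is a Num.int.

Lemma int_mxM (m n p : nat) (M : 'M[R]_(m, n)) (N : 'M[R]_(n, p)) :
  int_mx M -> int_mx N -> int_mx (M *m N).
Proof. by move=> iM iN i j; rewrite mxE rpred_sum // => k _; rewrite rpredM. Qed.

Lemma int_mxB (m n : nat) (M N : 'M[R]_(m, n)) :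
  int_mx M -> int_mx N -> int_mx (M - N).
Proof. by move=> iM iN i j; rewrite !mxE rpredB. Qed.

Lemma int_mx_subst_col (m n : nat) (M : 'M[R]_(m, n)) j0 v :
  int_mx M -> int_mx v -> int_mx (subst_col M j0 v).
Proof. by move=> iM iv i j; rewrite mxE; case: ifP. Qed.

Lemma det_int (d : nat) (M : 'M[R]_d) : int_mx M -> \det M \is a Num.int.
Proof.
move=> intM; apply: rpred_sum => s _; rewrite rpredMsign.
by apply: rpred_prod => i _; exact: intM.
Qed.

(* If [w = M x] in [W] has a coordinate [x_i] outside Z, replacing column [i] of
   [M] by [M (x - round x)] at least halves [|det M|] and stays inside the
   lattice spanned by [w] and the columns of [M]. *)
Lemma integrality_generators (d n : nat) (W : set 'cV[R]_d) (M : 'M[R]_d) :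
  (forall w, W w -> int_mx w) -> W 0 ->
  int_mx M -> \det M != 0 -> `|\det M| < (2 ^ n)%:R ->
  exists2 gs : n.-tuple 'cV[R]_d, (forall g, g \in gs -> W g) &
    forall u : 'rV[R]_d, int_mx (u *m M) ->
      (forall g, g \in gs -> int_mx (u *m g)) ->
      forall w, W w -> int_mx (u *m w).
Proof.
move=> intW W0; elim: n M => [|n IH] M intM detM ltM.
  (* A nonzero integer determinant has absolute value at least 1 = 2^0. *)
  by have := norm_intr_ge1 (det_int intM) detM; rewrite leNgt ltM.
have uM : M \in unitmx by rewrite unitmxE unitfE.
have [allint|] := pselect (forall w, W w -> int_mx (invmx M *m w)).
  (* The column lattice of [M] already contains [W]; zero vectors pad the tuple to its fixed
     length. *)
  exists [tuple of nseq n.+1 0] => [g /nseqP[->] //|u intu _ w Ww].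
  by rewrite -(mulKVmx uM w) (mulmxA u); exact: int_mxM (allint _ Ww).
move=> /existsNP[w /not_implyP[Ww nint]].
have [i [j0 /negP xi]] : exists i j, ~ ((invmx M *m w) i j \is a Num.int).
  by move/existsNP: nint => [i /existsNP[j ?]]; exists i, j.
rewrite {}(ord1 j0) in xi.
pose x := invmx M *m w.
(* Rounding to the nearest integer leaves the entries of [z] in [-1/2, 1/2]. *)
pose r := map_mx (fun t => (Num.floor (t + 2^-1))%:~R : R) x.
pose z := x - r.
have intr : int_mx r by move=> k l; rewrite mxE intr_int.
have wE : M *m z = w - M *m r by rewrite mulmxBr mulKVmx.
have zi : `|z i 0| <= 2^-1.
  rewrite /z /r mxE [X in _ + X]mxE [X in _ - X]mxE.
  have /andP[] := floor_itv (x i 0 + 2^-1); rewrite intrD.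
  by move=> h1 h2; rewrite ler_norml; apply/andP; split; lra.
have zi0 : z i 0 != 0.
  apply: contraNneq xi; rewrite /z /r mxE [X in _ + X]mxE [X in _ - X]mxE.
  by move=> /subr0_eq; rewrite -/x => ->; rewrite intr_int.
have intz : int_mx (M *m z).
  by rewrite wE; apply: int_mxB; [exact: intW | exact: int_mxM].
have [||| gs Wgs gsP] := IH (subst_col M i (M *m z)).
- exact: int_mx_subst_col.
- by rewrite det_subst_col mulf_neq0.
- rewrite det_subst_col normrM.
  have : `|\det M| * `|z i 0| <= `|\det M| * 2^-1 by rewrite ler_wpM2l.
  move: ltM; rewrite expnS natrM; lra.
(* The new column is [w - M *m r]: testing [u] on [w] and on [M] makes its product with [u]
   integral. *)
exists [tuple of w :: gs] => [g|u uM' ugs].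
  by rewrite inE => /orP[/eqP->//|]; exact: Wgs.
apply: gsP => [|g ggs]; last by apply: ugs; rewrite inE ggs orbT.
rewrite mulmx_subst_col wE mulmxBr mulmxA.
apply: int_mx_subst_col => //; apply: int_mxB; last exact: int_mxM.
by apply: ugs; rewrite inE eqxx.
Qed.

(** * Determinant bound and extraction of bases *)

Lemma fact_leq_exp (m n : nat) : (n <= m -> n`! <= m ^ n)%N.
Proof.
elim: n => // n IH nm; rewrite factS expnS leq_mul //; exact/IH/ltnW.
Qed.

(** The Leibniz expansion has [d!] terms, each of absolute value at most 1. *)
Lemma norm_det_le_fact (d : nat) (M : 'M[R]_d) :
  (forall i j, `|M i j| <= 1) -> `|\det M| <= (d`!)%:R.
Proof.
move=> M1; apply: le_trans (ler_norm_sum _ _ _) _.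
have -> : (d`!)%:R = \sum_(s : 'S_d) (1 : R).
  by rewrite sumr_const -card_Sn cardE.
apply: ler_sum => s _; rewrite normrM normrX normrN1 expr1n mul1r normr_prod.
by apply: prodr_ile1 => i _; rewrite normr_ge0 M1.
Qed.

Lemma spanning_unitmx (d : nat) (A : set 'cV[R]_d) :
  linearly_spanning A ->
  exists2 M : 'M[R]_d, M \in unitmx & forall j, A (col j M).
Proof.
move=> spanA; have [Y [fY AY spanY]] := free_generating_seq A.
have fullY v : v \in <<Y>>%VS.
  have [X AX vX] := spanA v; apply: subvP vX; apply/span_subvP => x xX.
  exact/spanY/AX.
have szY : size Y == d.
  rewrite -(eqP fY) (_ : <<Y>>%VS = fullv) ?dimvf /dim /= ?muln1 //.
  by apply/vspaceP => v; rewrite memvf fullY.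
pose Yt : d.-tuple _ := Tuple szY.
pose M := \matrix_(i, j) (Yt`_j) i 0 : 'M[R]_d.
have colM j : col j M = Yt`_j by apply/colP => i; rewrite !mxE.
exists M; last by move=> j; rewrite colM; apply: AY; rewrite mem_nth // (eqP szY).
(* Column [j] holds the coordinates of the [j]-th unit vector in the basis, so [N] is a right
   inverse of [M]. *)
pose N := \matrix_(i, j) coord Yt i (col j 1%:M) : 'M[R]_d.
suff /mulmx1_unit[] : M *m N = 1%:M by [].
have sumY (v : 'cV[R]_d) : v = \sum_(k < d) coord Yt k v *: Yt`_k.
  exact: (@coord_span _ _ _ Yt _ (fullY v)).
apply/matrixP => i j; transitivity (col j 1%:M i 0 : R); last by rewrite mxE.
rewrite [in RHS](sumY (col j 1%:M)) mxE summxE; apply: eq_bigr => k _.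
by rewrite !mxE mulrC.
Qed.

(** * Quadratic forms on 0/1 vectors *)

Definition qform (d : nat) (Q : 'M[R]_d) (a : 'cV[R]_d) : R :=
  (a^T *m Q *m a) 0 0.

Lemma qformE (d : nat) (Q : 'M[R]_d) a :
  qform Q a = \sum_i \sum_j a i 0 * a j 0 * Q i j.
Proof.
rewrite /qform mxE exchange_big; apply: eq_bigr => j _ /=.
by rewrite mxE mulr_suml; apply: eq_bigr => i _; rewrite !mxE; ring.
Qed.

Lemma qform_sum (d : nat) (I : Type) (r : seq I) (F : I -> 'M[R]_d) a :
  qform (\sum_(i <- r) F i) a = \sum_(i <- r) qform (F i) a.
Proof. by rewrite /qform mulmx_sumr mulmx_suml summxE. Qed.

Lemma qformZ (d : nat) k (Q : 'M[R]_d) a : qform (k *: Q) a = k * qform Q a.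
Proof. by rewrite /qform -scalemxAr -scalemxAl mxE. Qed.

Lemma qform_span0 (d : nat) (Y : seq 'M[R]_d) a Q :
  (forall y, y \in Y -> qform y a = 0) -> Q \in <<Y>>%VS -> qform Q a = 0.
Proof.
move=> Y0 QY; rewrite (coord_span (QY : Q \in <<in_tuple Y>>%VS)) qform_sum.
by rewrite big1 // => i _; rewrite qformZ Y0 ?mulr0 // mem_nth.
Qed.

Definition zero_one_mx (m n : nat) (M : 'M[R]_(m, n)) :=
  forall i j, zero_one (M i j).

(* On 0/1 vectors [a], where [a_i = a_i ^ 2], this form takes the value
   [<a, x> ^ 2 - <a, x>]. *)
Definition quad_mx (d : nat) (x : 'cV[R]_d) : 'M[R]_d :=
  x *m x^T - diag_mx x^T.

Lemma qform_quad_mx (d : nat) (x a : 'cV[R]_d) :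
  zero_one_mx a -> qform (quad_mx x) a = dotv a x * (dotv a x - 1).
Proof.
move=> a01; rewrite /qform /quad_mx mulmxBr mulmxBl mxE [X in _ + X]mxE.
rewrite mulrBr mulr1; congr (_ - _).
  rewrite mulmxA -mulmxA mxE big_ord1; congr (_ * _).
  by rewrite /dotv !mxE; apply: eq_bigr => i _; rewrite !mxE mulrC.
rewrite mul_mx_diag /dotv !mxE; apply: eq_bigr => i _; rewrite !mxE.
by case: (a01 i 0) => ->; ring.
Qed.

Lemma norm_quad_mx (d : nat) (x : 'cV[R]_d) i j :
  (forall i, `|x i 0| <= 1) -> `|quad_mx x i j| <= 2.
Proof.
move=> x1; rewrite !mxE big_ord1 !mxE; apply: le_trans (ler_normB _ _) _.
have h1 : `|x i 0 * x j 0| <= 1 by rewrite normrM mulr_ile1.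
have h2 : `|x i 0 *+ (i == j)| <= 1.
  by case: (i == j); rewrite ?mulr1n ?mulr0n ?normr0.
by have := lerD h1 h2; rewrite -natr1.
Qed.

(** The shift by [c] lets a finite type of naturals encode signed coefficients. *)
Definition shifted_mx (d L c : nat) (q : 'M['I_L]_d) : 'M[R]_d :=
  \matrix_(i, j) ((q i j)%:R - c%:R).

(** Entrywise [q] is the floor of [m * Q + m * c], which is nonnegative; each entry loses less than
    1, so the form loses at most [d * d] on a 0/1 vector. *)
Lemma qform_rounding (d m c L : nat) (Q : 'M[R]_d) :
  (2 * (m * c) < L)%N -> (forall i j, `|Q i j| <= c%:R) ->
  exists q : 'M['I_L]_d, forall a, zero_one_mx a ->
    m%:R * qform Q a - (d * d)%:R <= qform (shifted_mx (m * c) q) a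
      <= m%:R * qform Q a.
Proof.
move=> ltL Qc; have L_gt0 : (0 < L)%N by exact: leq_ltn_trans ltL.
pose t i j : R := m%:R * Q i j + (m * c)%:R.
have mQ i j : - (m * c)%:R <= m%:R * Q i j <= (m * c)%:R.
  by rewrite -ler_norml normrM natrM normr_nat ler_wpM2l.
have t0 i j : 0 <= t i j by rewrite /t; have /andP[] := mQ i j; lra.
have ltt i j : (Num.truncn (t i j) < L)%N.
  rewrite truncn_lt_nat // (le_lt_trans _ (_ : (2 * (m * c))%:R < _)) ?ltr_nat //.
  by rewrite natrM /t; have /andP[] := mQ i j; lra.
exists (\matrix_(i, j) Ordinal (ltt i j)) => a a01; rewrite !qformE.
have -> : (d * d)%:R = \sum_(i < d) \sum_(j < d) 1 :> R.
  rewrite (eq_bigr (fun=> d%:R)) => [|i _]; rewrite sumr_const card_ord //.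
  by rewrite mulrnA.
rewrite mulr_sumr -sumrB; apply/andP; split; apply: ler_sum => i _;
  rewrite mulr_sumr -?sumrB; apply: ler_sum => j _; rewrite !mxE /=.
all: have /andP[] := truncn_itv (t0 i j); rewrite -natr1 /t.
all: by case: (a01 i 0) => ->; case: (a01 j 0) => ->; lra.
Qed.

(** * Codes and their decoding *)

Definition bool_mx (m n : nat) (s : 'M[bool]_(m, n)) : 'M[R]_(m, n) :=
  map_mx (fun b : bool => b%:R) s.

Lemma zero_one_mxE (m n : nat) (M : 'M[R]_(m, n)) :
  zero_one_mx M -> bool_mx (map_mx (fun t => t == 1) M) = M.
Proof.
move=> M01; apply/matrixP => i j; rewrite !mxE.
by case: (M01 i j) => ->; rewrite ?eqxx // eq_sym oner_eq0.
Qed.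

Lemma zero_one_int (m n : nat) (M : 'M[R]_(m, n)) : zero_one_mx M -> int_mx M.
Proof.
by move=> M01 i j; case: (M01 i j) => ->; rewrite ?rpred0 ?rpred1.
Qed.

Lemma int_mul_pred_ge0 (t : R) : t \is a Num.int -> 0 <= t * (t - 1).
Proof.
move=> tint; have [t0|t0] := lerP t 0; first by nra.
have := norm_intr_ge1 tint (lt0r_neq0 t0); rewrite gtr0_norm // => t1; nra.
Qed.

(* The components are the pairing matrix of two bases, the vectors [b] (given by
   their pairings with the basis of [A]) against which integrality is tested, and
   the rounded quadratic form. *)
Definition code (d : nat) : finType :=
  ('M[bool]_d * (d * up_log 2 d).+1.-tuple 'cV[bool]_d *
   'M['I_(2 ^ (4 * up_log 2 d + 4))]_d)%type.

(** The scale [(d * d).+1] separates the values of the exact form: 0 is rounded to at most 0, and a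
    value of at least 1 to at least [(d * d).+1 - d * d = 1]. The factor [2 * (d * d)] bounds the
    entries of a sum of at most [d * d] forms with entries at most 2. *)
Definition decode (d : nat) (k : code d) : set 'cV[R]_d :=
  [set a | [/\ zero_one_mx a,
     forall g, g \in k.1.2 -> int_mx (a^T *m invmx (bool_mx k.1.1) *m bool_mx g) &
     qform (shifted_mx ((d * d).+1 * (2 * (d * d))) k.2) a <= 0]].

Lemma size_quad_bound (d : nat) :
  (2 * ((d * d).+1 * (2 * (d * d))) < 2 ^ (4 * up_log 2 d + 4))%N.
Proof.
have := up_logP d (isT : 1 < 2)%N; set e := (2 ^ _)%N => de.
have e0 : (0 < e)%N by rewrite expn_gt0.
have -> : (2 ^ (4 * up_log 2 d + 4) = (e * e) * (e * e) * 16)%N.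
  by rewrite expnD mulnC [(4 * _)%N]mulnC expnM -/e /=; lia.
have dd : (d * d <= e * e)%N by exact: leq_mul.
move: dd; have : (0 < e * e)%N by rewrite muln_gt0 e0.
move: (d * d)%N (e * e)%N => x y; nia.
Qed.

Lemma exists_code (d : nat) (X : set 'cV[R]_d) (S : 'M[R]_d) :
  zero_one_mx S -> S \in unitmx -> X 0 ->
  (forall x, X x -> zero_one_mx (S *m x)) ->
  (forall x i, X x -> `|x i 0| <= 1) ->
  exists k : code d, decode k =
    [set a | zero_one_mx a /\ forall x, X x -> zero_one (dotv a x)].
Proof.
move=> S01 uS X0 SX X1.
have detS : \det S != 0 by rewrite -unitfE -unitmxE.
(* From [d! <= d ^ d <= 2 ^ (d * up_log 2 d)]; strictness costs the extra 1 in the length of the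
   tuple. *)
have detlt : `|\det S| < (2 ^ (d * up_log 2 d).+1)%:R.
  apply: le_lt_trans (norm_det_le_fact _) _.
    by move=> i j; case: (S01 i j) => ->; rewrite ?normr0 ?normr1.
  rewrite ltr_nat (@leq_ltn_trans (2 ^ (d * up_log 2 d))) ?ltn_exp2l //.
  by rewrite mulnC expnM fact_leq_exp // up_logP.
pose W := [set S *m x | x in X].
have W01 w : W w -> zero_one_mx w by move=> [x Xx <-]; exact: SX.
have [||| gs Wgs gsP] := integrality_generators (W := W) (M := S) _ _ _ detS detlt.
- by move=> w /W01; exact: zero_one_int.
- by exists 0; rewrite ?mulmx0.
- exact: zero_one_int.
have [Y [fY YX spanY]] := free_generating_seq [set quad_mx x | x in X].
have szY : (size Y <= d * d)%N.
  by rewrite -(eqP fY) (leq_trans (dimvS (subvf _))) // dimvf /dim.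
pose Q : 'M[R]_d := \sum_(y <- Y) y.
have Q_le i j : `|Q i j| <= (2 * (d * d))%:R.
  rewrite /Q summxE; apply: le_trans (ler_norm_sum _ _ _) _.
  apply: (@le_trans _ _ (\sum_(y <- Y) 2)).
    rewrite !big_seq; apply: ler_sum => y /YX[x Xx <-].
    by apply: norm_quad_mx => i'; exact: X1.
  by rewrite big_const_seq count_predT iter_addr_0 -mulrnA ler_nat leq_mul2l szY.
have [q qP] := qform_rounding (size_quad_bound d) Q_le.
have uS_x (a x : 'cV[R]_d) : a^T *m invmx S *m (S *m x) = a^T *m x.
  by rewrite -mulmxA mulKmx.
exists (map_mx (fun t => t == 1) S, [tuple of map (map_mx (fun t => t == 1)) gs], q).
apply/seteqP; split => a; rewrite /decode /= zero_one_mxE //.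
- move=> [a01 aint aq]; split=> // x0 Xx0.
  (* The tests are applied to the row [u = a^T S^-1], for which [u S = a^T] is integral because [a]
     is 0/1. *)
  have intax x : X x -> dotv a x \is a Num.int.
    move=> Xx; rewrite /dotv -uS_x; apply: gsP; last by exists x.
      rewrite -mulmxA mulVmx // mulmx1 => i j; rewrite mxE.
      exact: zero_one_int.
    move=> g ggs; have := aint (map_mx (fun t => t == 1) g) (map_f _ ggs).
    by rewrite zero_one_mxE //; exact/W01/Wgs.
  have qY y : y \in Y -> qform y a \is a Num.int /\ 0 <= qform y a.
    move=> /YX[x Xx <-]; rewrite qform_quad_mx //; split.
      by rewrite rpredM ?rpredB ?rpred1 ?intax.
    exact/int_mul_pred_ge0/intax.
  have Qint : qform Q a \is a Num.int.
    by rewrite qform_sum big_seq rpred_sum // => y /qY[].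
  have Q0 : 0 <= qform Q a.
    by rewrite qform_sum big_seq sumr_ge0 // => y /qY[].
  (* Rounding gives [(d * d).+1 * Q(a) - d * d <= 0]. *)
  have Qlt1 : qform Q a < 1.
    have /andP[+ _] := qP a a01; rewrite -natr1.
    have := ler0n R (d * d); nra.
  have {}Q0 : qform Q a = 0.
    apply/eqP; apply: contraTT Qlt1 => /(norm_intr_ge1 Qint).
    by rewrite ger0_norm // leNgt.
  (* Nonnegative terms of sum zero all vanish, and then so does every form in their span. *)
  have qx0 : qform (quad_mx x0) a = 0.
    apply: (@qform_span0 _ Y); last by apply: spanY; exists x0.
    move=> y yY; apply/eqP; move/eqP: Q0; rewrite qform_sum big_seq psumr_eq0.
      by move=> /allP/(_ y yY); rewrite yY.
    by move=> y' /qY[].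
  move/eqP: qx0; rewrite qform_quad_mx // mulf_eq0 subr_eq0.
  by move=> /orP[] /eqP; [left | right].
- move=> [a01 aX]; split=> //.
  - move=> _ /mapP[g /[dup] /Wgs Wg _ ->]; rewrite zero_one_mxE; last exact: W01.
    have [x Xx <-] := Wg; rewrite uS_x => i j; rewrite !ord1 -/(dotv a x).
    by case: (aX x Xx) => ->; rewrite ?rpred0 ?rpred1.
  - have /andP[_] := qP a a01; suff -> : qform Q a = 0 by rewrite mulr0.
    rewrite qform_sum big_seq big1 // => y /YX[x Xx <-].
    by rewrite qform_quad_mx //; case: (aX x Xx) => ->; ring.
Qed.

(** * Normalising and encoding a configuration *)

Lemma dotv_trmx (d : nat) (M : 'M[R]_d) a b : dotv (M^T *m a) b = dotv a (M *m b).
Proof. by rewrite /dotv trmx_mul trmxK mulmxA. Qed.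

Lemma mulmx_entry_dotv (d m n : nat) (M : 'M[R]_(d, m)) (N : 'M[R]_(d, n)) i j :
  (M^T *m N) i j = dotv (col i M) (col j N).
Proof. by rewrite /dotv !mxE; apply: eq_bigr => k _; rewrite !mxE. Qed.

(** By maximality the first set determines the second, so only the first is encoded. *)
Definition decode_config (d : nat) (k : code d) : config R d :=
  (decode k, [set b | forall a, decode k a -> zero_one (dotv a b)]).

(* Among the bases of R^d made of vectors of [B], choose one maximising the
   determinant: by Cramer's rule all of [B] has coordinates in [-1, 1]. *)
Lemma max_det_basis (d : nat) (c : config R d) : two_level_config c ->
  exists (M N : 'M[R]_d),
    [/\ M \in unitmx, N \in unitmx, forall i, c.1 (col i M),
        forall j, c.2 (col j N) &
        forall b i, c.2 b -> `|(invmx N *m b) i 0| <= 1].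
Proof.
case: c => A B [/= spanA spanB AB01 _ _].
have [M uM AM] := spanning_unitmx spanA; have [N0 uN0 BN0] := spanning_unitmx spanB.
have zoMN (N : 'M[R]_d) : (forall j, B (col j N)) -> zero_one_mx (M^T *m N).
  by move=> BN i j; rewrite mulmx_entry_dotv; exact: AB01.
(* The maximum is taken over the finitely many 0/1 pairing matrices [M^T N]; their determinants are
   those of [N] times the fixed [\det M]. *)
pose P (s : 'M[bool]_d) := `[< exists2 N : 'M[R]_d, forall j, B (col j N) &
  M^T *m N = bool_mx s >].
have PN N (BN : forall j, B (col j N)) : P (map_mx (fun t => t == 1) (M^T *m N)).
  by apply/asboolP; exists N; rewrite ?zero_one_mxE //; exact: zoMN.
case: (arg_maxP (fun s => `|\det (bool_mx s)|) (PN N0 BN0)) => s.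
move=> /asboolP[N BN eN] smax.
have maxN N' : (forall j, B (col j N')) -> `|\det N'| <= `|\det N|.
  move=> BN'; have := smax _ (PN N' BN'); rewrite /= zero_one_mxE; last exact: zoMN.
  by rewrite -eN !det_mulmx !normrM ler_pM2l // normr_gt0 det_tr -unitfE -unitmxE.
have N_gt0 : 0 < `|\det N|.
  by apply: lt_le_trans (maxN _ BN0); rewrite normr_gt0 -unitfE -unitmxE.
have uN : N \in unitmx by rewrite unitmxE unitfE -normr_gt0.
exists M, N; split=> // b i Bb.
rewrite -(ler_pM2l N_gt0) -normrM -det_subst_col mulKVmx // mulr1.
apply: maxN => j; have [->|/eqP ne_ji] := eqVneq j i.
  by rewrite (_ : col i _ = b) //; apply/colP => k; rewrite !mxE eqxx.
rewrite (_ : col j _ = col j N) //; apply/colP => k; rewrite !mxE.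
by move/eqP/negPf: ne_ji => ->.
Qed.

(** The map [a -> N^T a], [b -> N^-1 b] preserves pairings. Since the columns of [N] lie in [B], it
    sends [A] to 0/1 vectors, namely those whose pairings with [X] are all 0 or 1. *)
Lemma config_code (d : nat) (c : config R d) : two_level_config c ->
  exists k : code d, linearly_equivalent c (decode_config k).
Proof.
move=> cP; have [M [N [uM uN AM BN N1]]] := max_det_basis cP.
case: c cP AM BN N1 => A B [/= _ _ AB01 EA EB] AM BN N1.
have uS : M^T *m N \in unitmx by rewrite unitmx_mul unitmx_tr uM.
pose X := [set invmx N *m b | b in B].
have [|||| k kE] := exists_code (X := X) (S := M^T *m N) _ uS.
- by move=> i j; rewrite mulmx_entry_dotv; exact: AB01.
- exists 0; rewrite ?mulmx0 // EB => a _; left.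
  by rewrite /dotv mulmx0 mxE.
- move=> _ [b Bb <-] i j; rewrite mulmxA mulmxK // !ord1.
  by rewrite mulmx_entry_dotv col_id; exact: AB01.
- by move=> _ i [b Bb <-]; exact: N1.
have kN a : A a -> decode k (N^T *m a).
  move=> Aa; rewrite kE; split=> [i j|_ [b Bb <-]].
    by rewrite !ord1 -[a]trmxK -trmx_mul mxE mulmx_entry_dotv col_id; exact: AB01.
  by rewrite dotv_trmx mulKVmx //; exact: AB01.
exists k, (invmx N); rewrite ?unitmx_inv // invmxK /=; split; apply/seteqP; split.
- move=> a ka; exists ((invmx N)^T *m a).
    rewrite EA => b Bb; rewrite dotv_trmx.
    by move: ka; rewrite kE => -[_]; apply; exists b.
  by rewrite mulmxA -trmx_mul mulVmx // trmx1 mul1mx.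
- by move=> _ [a Aa <-]; exact: kN.
- move=> b kb; exists (N *m b); last by rewrite mulKmx.
  by rewrite EB => a Aa; rewrite -dotv_trmx; exact/kb/kN.
- by move=> _ [b Bb <-] a; rewrite kE => -[_]; apply; exists b.
Qed.

End Configurations.

(** * Counting codes and asymptotics *)

Definition code_length (d : nat) : nat :=
  (d * d + d * (d * up_log 2 d).+1 + d * d * (4 * up_log 2 d + 4))%N.

Lemma card_code (d : nat) : #|code d| = (2 ^ code_length d)%N.
Proof.
rewrite /code !card_prod card_tuple !card_mx card_bool card_ord muln1.
by rewrite -!expnM -!expnD; congr (2 ^ (_ + _))%N; rewrite mulnC.
Qed.

Lemma card_equiv_classes (R : realType) (d : nat) :
  finite_set (@equiv_classes R d) /\
  (#|` fset_set (@equiv_classes R d)| <= 2 ^ code_length d)%N%fset.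
Proof.
pose F (k : code d) : set (config R d) := equiv_class (decode_config R k).
(* Configurations sharing a code are equivalent to the same decoded pair. A code may decode to a
   pair that is not a configuration, hence only an inclusion. *)
have subF : @equiv_classes R d `<=` [set` [fset F k | k in code d]%fset].
  move=> _ [c cP <-]; have [k ck] := config_code cP.
  rewrite /= (_ : equiv_class c = F k); first by apply/imfsetP; exists k.
  apply/seteqP; split => c' [c'P cc']; split=> //.
    exact: linearly_equivalent_trans (linearly_equivalent_sym ck) cc'.
  exact: linearly_equivalent_trans ck cc'.
have fin : finite_set (@equiv_classes R d).
  exact: sub_finite_set subF (finite_fset _).
split=> //; rewrite -card_code.
apply: leq_trans (_ : #|` [fset F k | k in code d]%fset| <= _)%N.
  by apply: fsubset_leq_card; rewrite -[X in (_ `<=` X)%fset]set_fsetK -fset_set_sub.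
by apply: leq_trans (leq_imfset_card _ _ _) _; rewrite cardE.
Qed.

(** With [up_log 2 d = l + 1] one has [2 ^ l < d], so [l <= log2 d]; the remaining 1 is at most
    [log2 d] as [d >= 2]. *)
Lemma up_log_le_log2 (R : realType) (d : nat) :
  (1 < d)%N -> (up_log 2 d)%:R <= 2 * log2 (d%:R : R).
Proof.
move=> d1; have ln2 : 0 < ln 2 :> R by rewrite ln_gt0 // ltr1n.
have := up_log_gtn (isT : 1 < 2)%N d1.
have : (0 < up_log 2 d)%N by rewrite up_log_gt0.
case: (up_log 2 d) => // l _ /= ltd; rewrite /log2 mulrA ler_pdivlMr //.
have d0 : (0 : R) < d%:R by rewrite ltr0n; lia.
have h1 : ln 2 <= ln (d%:R : R) by rewrite ler_ln ?posrE // ler_nat.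
have h2 : l%:R * ln 2 <= ln (d%:R : R).
  by rewrite -ln_powR powR_mulrn // ler_ln ?posrE ?exprn_gt0 // -natrX ler_nat ltnW.
by rewrite -natr1; lra.
Qed.

Lemma code_length_bound (R : realType) (d : nat) : (1 < d)%N ->
  (code_length d)%:R <= 22 * (d%:R ^+ 2 * log2 (d%:R : R) ^+ 3).
Proof.
move=> d1; have l0 : (0 < up_log 2 d)%N by rewrite up_log_gt0.
have ln2 : 0 < ln 2 :> R by rewrite ln_gt0 // ltr1n.
have L1 : 1 <= log2 (d%:R : R).
  by rewrite ler_pdivlMr // mul1r ler_ln ?posrE ?ltr0n ?ler_nat //; lia.
have := up_log_le_log2 R d1; set L := log2 _ in L1 * => lL.
(* With [l = up_log 2 d >= 1], the three summands are at most 1, 2 and 8 times [d * d * l]; then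
   [l <= 2 * L] turns 11 into 22. *)
apply: (@le_trans _ _ (11 * (d * d * up_log 2 d))%:R).
  rewrite ler_nat /code_length; move: (up_log 2 d) l0 => l l0; nia.
rewrite !natrM expr2; apply: (@le_trans _ _ (11 * (d%:R * d%:R * (2 * L)))).
  by rewrite ler_pM2l // ler_wpM2l // mulr_ge0.
have : L <= L ^+ 3 by rewrite ler_eXnr.
have : 0 <= d%:R * d%:R :> R by rewrite mulr_ge0.
move: (d%:R * d%:R) => D; nra.
Qed.

Theorem theorem1p2 (R : realType) :
  exists f : nat -> R,
    f =O_\oo (fun d : nat => d%:R ^+ 2 * log2 (d%:R : R) ^+ 3) /\
    (forall d : nat,
       finite_set (@equiv_classes R d) /\
       (#|` fset_set (@equiv_classes R d)|%fset)%:R <= (2 : R) `^ f d).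
Proof.
exists (fun d => (code_length d)%:R); split=> [|d].
  (* The bound is only eventual: at [d = 1] the logarithm vanishes while the code length is
     positive. *)
  apply/eqO_exP; exists 22 => //; near=> d.
  rewrite ger0_norm //; apply: le_trans (ler_wpM2l _ (ler_norm _)) => //.
  apply: code_length_bound; near: d; exact: nbhs_infty_gt.
have [fin le] := card_equiv_classes R d; split=> //.
by rewrite powR_mulrn // -natrX ler_nat.
Unshelve. all: by end_near.
Qed.
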